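(* Let $A\colon\mathcal{D}(A)\subseteq\mathcal{H}\to\mathcal{K}$ be a closed, densely defined unbounded operator between Hilbert spaces and let $A=UT_\sigma V^*$ be the condensed singular value decomposition of $A$. Then $$\mathcal{R}(U)=\overline{\mathcal{R}(A)},\quad\mathcal{N}(V^* )=\mathcal{N}(A),\quad VV^*=P_{\mathcal{N}(A)^\perp},\quad UU^*=P_{\overline{\mathcal{R}(A)}}.$$
   Context: All Hilbert spaces are separable and complex. ''Unbounded operator'' means a linear operator defined on a subspace; bounded operators are included. $\mathcal{R}$ and $\mathcal{N}$ denote range and kernel, and $P_{\mathcal{X}}$ is the orthogonal projection onto a closed subspace $\mathcal{X}$. A condensed singular value decomposition $A=UT_\sigma V^*$ consists of a $\sigma$-finite Borel measure space $(M,\mu)$, isometries $U\in\mathcal{L}(L^2_\mu,\mathcal{K})$, $V\in\mathcal{L}(L^2_\mu,\mathcal{H})$ with $L^2_\mu=L^2(M,\mu)$, and a measurable $\sigma\colon M\to[0,\infty)$ positive almost everywhere, such that, with $T_\sigma$ multiplication by $\sigma$ on $\mathcal{D}(T_\sigma)=\{f\in L^2_\mu:\sigma f\in L^2_\mu\}$, one has $\mathcal{D}(A)=\{x\in\mathcal{H}:V^*x\in\mathcal{D}(T_\sigma)\}$ and $Ax=UT_\sigma V^*x$ for all $x\in\mathcal{D}(A)$. *)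

(* Defs.v *)
From HB Require Import structures.
From mathcomp Require Import all_boot all_order all_algebra.
From mathcomp Require Import generic_quotient ring_quotient sesquilinear.
From mathcomp Require Import complex.
From mathcomp Require Import all_classical all_reals all_analysis.
From mathcomp Require Import measurable_realfun ring lra.
Set Implicit Arguments.
Unset Strict Implicit.
Unset Printing Implicit Defensive.
Import Order.TTheory GRing.Theory Num.Theory.
Import numFieldNormedType.Exports.
Local Open Scope classical_set_scope.
Local Open Scope ring_scope.
Local Open Scope complex_scope.
Local Open Scope quotient_scope.

(* The form is linear in its first argument, antilinear in the second. *)
HB.mixin Record hasInner (R : realType) (H : Type) & NormedModule R[i] H := {
  inner : {dot H for @Num.conj R[i]};
  inner_normE : forall x : H, inner x x = `|x| ^+ 2
}.

#[short(type="preHilbertType")]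
HB.structure Definition PreHilbert (R : realType) :=
  {H of hasInner R H & NormedModule R[i] H}.

#[short(type="hilbertType")]
HB.structure Definition Hilbert (R : realType) :=
  {H of PreHilbert R H & CompleteNormedModule R[i] H}.

Section DotNorm.
Variables (C : numClosedFieldType) (U : lmodType C).
Variable form : {dot U for @Num.conj C}.

Definition dot_norm (u : U) : C := sqrtC (form u u).

Lemma dot_norm_sqr u : dot_norm u ^+ 2 = form u u.
Proof. exact: sqrtCK. Qed.

Lemma dot_norm_ge0 u : 0 <= dot_norm u.
Proof. by rewrite sqrtC_ge0 dnorm_ge0. Qed.

Lemma dot_CauchySchwarz u v : `|form u v| <= dot_norm u * dot_norm v.
Proof.
have [->|v0] := eqVneq v 0.
  by rewrite linear0r normr0 mulr_ge0 ?dot_norm_ge0.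
have fv : 0 < form v v by rewrite neq0_dnorm_gt0.
have fv0 : form v v != 0 by rewrite gt_eqF.
have fvC : Num.conj (form v v) = form v v by rewrite conj_Creal// gtr0_real.
pose a := form u v / form v v.
have ow : form (u - a *: v) v = 0.
  by rewrite linearBl linearZl_LR /= /a divfK // subrr.
rewrite -(@ler_pXn2r _ 2) ?nnegrE ?mulr_ge0 ?dot_norm_ge0//.
rewrite exprMn !dot_norm_sqr.
have -> : form u u = form (u - a *: v) (u - a *: v) + `|a| ^+ 2 * form v v.
  rewrite -dnormZ -hnormDd ?subrK//.
  by rewrite linearZr_LR /= ow mulr0.
rewrite mulrDl ler_wpDl ?mulr_ge0 ?dnorm_ge0//.
by rewrite -mulrA -expr2 -[X in _ * X ^+ 2](ger0_norm (ltW fv)) -exprMn -normrM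
  /a divfK.
Qed.

Lemma dot_norm_triangle u v : dot_norm (u + v) <= dot_norm u + dot_norm v.
Proof.
rewrite -(@ler_pXn2r _ 2) ?nnegrE ?addr_ge0 ?dot_norm_ge0//.
rewrite sqrrD !dot_norm_sqr dnormD addrAC lerD2r lerD2l.
apply: le_trans (_ : `|form u v| *+ 2 <= _); last first.
  by rewrite lerMn2r dot_CauchySchwarz orbT.
apply: le_trans (real_ler_norm _) _.
  by rewrite CrealE rmorphD /= conjCK addrC.
by apply: le_trans (ler_normD _ _) _; rewrite norm_conjC mulr2n.
Qed.

Lemma dot_normZ a u : dot_norm (a *: u) = `|a| * dot_norm u.
Proof.
apply/eqP; rewrite -(@eqrXn2 _ 2) ?mulr_ge0 ?dot_norm_ge0//.
by rewrite exprMn !dot_norm_sqr dnormZ.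
Qed.

Lemma dot_norm0_eq0 u : dot_norm u = 0 -> u = 0.
Proof. by move/eqP; rewrite sqrtC_eq0 dnorm_eq0 => /eqP. Qed.

End DotNorm.

HB.factory Record Lmodule_isPreHilbert (R : realType) (H : Type)
    & GRing.Lmodule R[i] H := {
  form : {dot H for @Num.conj R[i]}
}.

HB.builders Context R H & Lmodule_isPreHilbert R H.

HB.instance Definition _ := @Lmodule_isNormed.Build R[i] H (dot_norm form)
  (dot_norm_triangle form) (dot_normZ form) (@dot_norm0_eq0 _ _ form).

Let inner_normE (x : H) : form x x = `|x| ^+ 2.
Proof. by rewrite -dot_norm_sqr. Qed.

HB.instance Definition _ := hasInner.Build R H inner_normE.

HB.end.

Section SquareIntegrable.
Context d (T : measurableType d) (R : realType).
Variable mu : {measure set T -> \bar R}.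
Implicit Types f g : T -> R[i].

(* Borel measurability of a complex function, through its two real parts. *)
Definition square_integrable f : Prop :=
  [/\ measurable_fun setT (fun x => complex.Re (f x)),
      measurable_fun setT (fun x => complex.Im (f x)) &
      (\int[mu]_x (Normc.normc (f x) ^+ 2)%:E < +oo)%E].

Definition L2pred : {pred T -> R[i]} := fun f => `[< square_integrable f >].

Lemma sqr_normc (z : R[i]) :
  Normc.normc z ^+ 2 = complex.Re z ^+ 2 + complex.Im z ^+ 2.
Proof. by case: z => a b /=; rewrite sqr_sqrtr// addr_ge0 ?sqr_ge0. Qed.

Lemma sqr_Lfun2 (u : T -> R) : measurable_fun setT u ->
  (\int[mu]_x (u x ^+ 2)%:E < +oo)%E -> u \in Lfun mu 2%:E.
Proof.
move=> mu' iu; rewrite inE; apply/andP; split; rewrite inE//=.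
rewrite /finite_norm unlock /=; apply: poweR_lty.
apply: le_lt_trans iu; rewrite le_eqVlt; apply/orP; left; apply/eqP.
by apply: eq_integral => x _; rewrite powR_mulrn// -normrX ger0_norm// sqr_ge0.
Qed.

Lemma square_integrableP f : square_integrable f <->
  (fun x => complex.Re (f x)) \in Lfun mu 2%:E /\
  (fun x => complex.Im (f x)) \in Lfun mu 2%:E.
Proof.
split=> [[mr mi fi]|[rL iL]].
  split; apply: sqr_Lfun2 => //; apply: le_lt_trans fi;
    apply: ge0_le_integral => //.
  - by move=> x _; rewrite lee_fin sqr_ge0.
  - by apply/measurable_EFinP; exact: measurable_funX.
  - apply/measurable_EFinP; under eq_fun do rewrite sqr_normc.
    by apply: measurable_funD; exact: measurable_funX.
  - by move=> x _; rewrite lee_fin sqr_normc lerDl sqr_ge0.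
  - by move=> x _; rewrite lee_fin sqr_ge0.
  - by apply/measurable_EFinP; exact: measurable_funX.
  - apply/measurable_EFinP; under eq_fun do rewrite sqr_normc.
    by apply: measurable_funD; exact: measurable_funX.
  - by move=> x _; rewrite lee_fin sqr_normc lerDr sqr_ge0.
have rm : measurable_fun setT (fun x => complex.Re (f x)).
  by move: rL => /[!inE] /andP[/[!inE]].
have im : measurable_fun setT (fun x => complex.Im (f x)).
  by move: iL => /[!inE] /andP[/[!inE]].
split => //.
have := integrableD measurableT (Lfun2_integrable_sqr rL)
  (Lfun2_integrable_sqr iL).
move=> /integrableP[_]; apply: le_lt_trans; rewrite le_eqVlt; apply/orP; left.
apply/eqP/eq_integral => x _.
by rewrite sqr_normc /= ger0_norm ?addr_ge0 ?sqr_ge0.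
Qed.

Lemma L2pred_submod_closed : submod_closed L2pred.
Proof.
split.
  apply/asboolP/square_integrableP; split;
    exact: (@Lfun_submod_closed _ T R mu 2%:E (lee1n 2)).1.
move=> a f g /asboolP/square_integrableP[fr fi] /asboolP/square_integrableP[gr gi].
apply/asboolP/square_integrableP.
have [_ L] := @Lfun_submod_closed _ T R mu 2%:E (lee1n 2).
split.
  rewrite [X in X \in _](_ : _ = complex.Re a *: (fun x => complex.Re (f x)) +
    ((- complex.Im a) *: (fun x => complex.Im (f x)) + (fun x => complex.Re (g x)))).
    by apply: (L) => //; apply: (L).
  apply/funext => x; rewrite !fctE /=.
  case: a (f x) (g x) => [a1 a2] [f1 f2] [g1 g2] /=.
  change (a1 * f1 - a2 * f2 + g1 = a1 * f1 + (- a2 * f2 + g1)); ring.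
rewrite [X in X \in _](_ : _ = complex.Re a *: (fun x => complex.Im (f x)) +
    (complex.Im a *: (fun x => complex.Re (f x)) + (fun x => complex.Im (g x)))).
  by apply: (L) => //; apply: (L).
apply/funext => x; rewrite !fctE /=.
by case: a (f x) (g x) => [a1 a2] [f1 f2] [g1 g2] /=; rewrite addrA.
Qed.

HB.instance Definition _ := GRing.isSubmodClosed.Build R[i] (T -> R[i]) L2pred
  L2pred_submod_closed.

Record L2fun := MkL2fun { L2val :> T -> R[i]; L2valP : L2val \in L2pred }.

HB.instance Definition _ := [isSub for L2val].
HB.instance Definition _ := [Choice of L2fun by <:].
HB.instance Definition _ := [SubChoice_isSubLmodule of L2fun by <:].

Lemma L2funE a (f g h : L2fun) x :
  (f - (a *: g + h)) x = f x - (a * g x + h x).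
Proof. by []. Qed.

Definition L2null : {pred L2fun} := fun f : L2fun => `[< {ae mu, forall x, f x = 0} >].

Lemma L2null_submod_closed : submod_closed L2null.
Proof.
split; first by apply/asboolP/nearW => x.
move=> a f g /asboolP f0 /asboolP g0; apply/asboolP.
by apply: filterS2 f0 g0 => x /= f0 g0; rewrite !fctE f0 g0 scaler0 addr0.
Qed.

HB.instance Definition _ := GRing.isSubmodClosed.Build R[i] L2fun L2null
  L2null_submod_closed.

Definition cintegrable (F : T -> R[i]) :=
  mu.-integrable setT (EFin \o (fun x => complex.Re (F x))) /\
  mu.-integrable setT (EFin \o (fun x => complex.Im (F x))).

Definition cintegral (F : T -> R[i]) : R[i] :=
  (\int[mu]_x complex.Re (F x)) +i* (\int[mu]_x complex.Im (F x)).

Lemma cintegralP (a : R[i]) F G : cintegrable F -> cintegrable G ->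
  cintegral (fun x => a * F x + G x) = a * cintegral F + cintegral G.
Proof.
move=> [iFr iFi] [iGr iGi].
have iZ r (u : T -> R) : mu.-integrable setT (EFin \o u) ->
    mu.-integrable setT (EFin \o (fun x => r * u x)).
  by move=> iu; exact: (integrableZl measurableT r iu).
have iD (u v : T -> R) : mu.-integrable setT (EFin \o u) ->
    mu.-integrable setT (EFin \o v) ->
    mu.-integrable setT (EFin \o (fun x => u x + v x)).
  by move=> iu iv; exact: (integrableD measurableT iu iv).
rewrite /cintegral; case: a => a1 a2.
have -> : (\int[mu]_x complex.Re ((a1 +i* a2) * F x + G x) =
   a1 * \int[mu]_x complex.Re (F x) - a2 * \int[mu]_x complex.Im (F x) +
   \int[mu]_x complex.Re (G x))%R.
  rewrite -mulNr -(RintegralZl a1 measurableT iFr).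
  rewrite -(RintegralZl (- a2) measurableT iFi).
  rewrite -RintegralD ?iZ// -RintegralD ?iD ?iZ//.
  apply: eq_Rintegral => x _.
  by case: (F x) (G x) => [f1 f2] [g1 g2] /=; ring.
have -> : (\int[mu]_x complex.Im ((a1 +i* a2) * F x + G x) =
   a1 * \int[mu]_x complex.Im (F x) + a2 * \int[mu]_x complex.Re (F x) +
   \int[mu]_x complex.Im (G x))%R.
  rewrite -(RintegralZl a1 measurableT iFi).
  rewrite -(RintegralZl a2 measurableT iFr).
  rewrite -RintegralD ?iZ// -RintegralD ?iD ?iZ//.
  apply: eq_Rintegral => x _.
  by case: (F x) (G x) => [f1 f2] [g1 g2] /=; ring.
by [].
Qed.

Lemma cintegral_conj F : cintegrable F ->
  cintegral (fun x => Num.conj (F x)) = Num.conj (cintegral F).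
Proof.
move=> [_ iFi].
have -> : Num.conj (cintegral F) =
  (\int[mu]_x complex.Re (F x)) -i* (\int[mu]_x complex.Im (F x)) by [].
congr (_ +i* _); first by apply: eq_Rintegral => x _; case: (F x).
rewrite -mulN1r -RintegralZl//; apply: eq_Rintegral => x _.
by rewrite mulN1r; case: (F x).
Qed.

Lemma eq_ae_cintegral F G : cintegrable F -> cintegrable G ->
  {ae mu, forall x, F x = G x} -> cintegral F = cintegral G.
Proof.
move=> [Fr Fi] [Gr Gi] FG; congr (_ +i* _); rewrite /Rintegral; congr fine;
  apply: ae_eq_integral => //; solve [ by case/integrableP: Fr
    | by case/integrableP: Fi | by case/integrableP: Gr
    | by case/integrableP: Gi | by apply: filterS FG => x /= -> ].
Qed.

Lemma L2_mul_cintegrable (f g : L2fun) :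
  cintegrable (fun x => f x * Num.conj (g x)).
Proof.
have /asboolP/square_integrableP[fr fi] := L2valP f.
have /asboolP/square_integrableP[gr gi] := L2valP g.
have P u v : u \in Lfun mu 2%:E -> v \in Lfun mu 2%:E ->
    mu.-integrable setT (EFin \o (fun x => u x * v x)).
  by move=> uL vL; apply/Lfun1_integrable; exact: Lfun2_mul_Lfun1.
split.
  have := integrableD measurableT (P _ _ fr gr) (P _ _ fi gi).
  apply: eq_integrable => // x _ /=.
  by case: (f x) (g x) => [f1 f2] [g1 g2] /=; rewrite -EFinD mulrN opprK.
have := integrableB measurableT (P _ _ fi gr) (P _ _ fr gi).
apply: eq_integrable => // x _ /=.
by case: (f x) (g x) => [f1 f2] [g1 g2] /=; rewrite -EFinB mulrN addrC.
Qed.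

Definition L2dot (f g : L2fun) : R[i] :=
  cintegral (fun x => f x * Num.conj (g x)).

Lemma L2dotPl a (f g h : L2fun) :
  L2dot (a *: f + g) h = a * L2dot f h + L2dot g h.
Proof.
rewrite /L2dot -cintegralP; try exact: L2_mul_cintegrable.
by congr cintegral; apply/funext => x; rewrite mulrA -mulrDl.
Qed.

Lemma L2dotC (f g : L2fun) : L2dot f g = Num.conj (L2dot g f).
Proof.
rewrite /L2dot -cintegral_conj; last exact: L2_mul_cintegrable.
by congr cintegral; apply/funext => x; rewrite rmorphM /= conjCK mulrC.
Qed.

Lemma L2dotE (f : L2fun) :
  L2dot f f = (\int[mu]_x (Normc.normc (f x) ^+ 2))%:C.
Proof.
congr (_ +i* _).
  apply: eq_Rintegral => x _; rewrite sqr_normc.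
  by case: (f x) => a b /=; ring.
rewrite -[RHS](_ : (\int[mu]_x cst (0:R) x = 0)%R); last first.
  by rewrite Rintegral_cst // mul0r.
apply: eq_Rintegral => x _.
by case: (f x) => a b /=; ring.
Qed.

Lemma L2dot_gt0 (f : L2fun) : f \notin L2null -> 0 < L2dot f f.
Proof.
move=> f0; rewrite L2dotE ltcR lt_neqAle Rintegral_ge0 ?andbT; last first.
  by move=> x _; exact: sqr_ge0.
apply: contra f0 => /eqP f0; have /asboolP[mr mi fi] := L2valP f.
have mf : measurable_fun setT (fun x => (Normc.normc (f x) ^+ 2)%:E).
  apply/measurable_EFinP; under eq_fun do rewrite sqr_normc.
  by apply: measurable_funD; exact: measurable_funX.
have i0 : (0 <= \int[mu]_x (Normc.normc (f x) ^+ 2)%:E)%E.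
  by apply: integral_ge0 => x _; rewrite lee_fin sqr_ge0.
have h : (\int[mu]_x (Normc.normc (f x) ^+ 2)%:E)%E = 0%E.
  by rewrite -[LHS]fineK ?ge0_fin_numE//; congr EFin; rewrite -[RHS]/(0%R) [RHS]f0.
apply/asboolP.
have : (\int[mu]_x `|(Normc.normc (f x) ^+ 2)%:E|)%E = 0%E.
  by rewrite -[RHS]h; apply: eq_integral => x _; rewrite gee0_abs// lee_fin sqr_ge0.
move=> /(ae_eq_integral_abs mu measurableT mf).
apply: filterS => x /= /(_ I) [] /eqP.
by rewrite sqrf_eq0 => /eqP /Normc.eq0_normc.
Qed.

Lemma L2dot_null (f g : L2fun) : f \in L2null -> L2dot f g = 0.
Proof.
move=> /asboolP f0.
rewrite /L2dot -[RHS](_ : cintegral (fun=> 0) = 0); last first.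
  by rewrite /cintegral !Rintegral_cst // !mul0r.
apply: eq_ae_cintegral; first exact: L2_mul_cintegrable.
  by split; exact: integrable0.
by apply: filterS f0 => x ->; rewrite mul0r.
Qed.

Definition L2 : Type := Quotient.quot L2null.
HB.instance Definition _ := Choice.on L2.
HB.instance Definition _ := EqQuotient.on L2.
HB.instance Definition _ := GRing.Zmodule.on L2.
HB.instance Definition _ := ZmodQuotient.on L2.

Lemma L2eqP (f g : L2fun) : reflect (\pi_L2 f = \pi_L2 g) (f - g \in L2null).
Proof. by rewrite Quotient.idealrBE; exact: eqP. Qed.

Lemma L2repr_null (f : L2fun) : repr (\pi_L2 f) - f \in L2null.
Proof. by apply/L2eqP; rewrite reprK. Qed.

Definition L2scale (a : R[i]) (x : L2) : L2 := \pi_L2 (a *: repr x).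

Lemma L2scale_pi a (f : L2fun) : L2scale a (\pi_L2 f) = \pi_L2 (a *: f).
Proof. by apply/L2eqP; rewrite -scalerBr rpredZ// L2repr_null. Qed.

Fact L2scaleA a b x : L2scale a (L2scale b x) = L2scale (a * b) x.
Proof. by rewrite -(reprK x) (L2scale_pi b) !L2scale_pi scalerA. Qed.

Fact L2scale1 : left_id 1 L2scale.
Proof. by move=> x; rewrite -(reprK x) !L2scale_pi scale1r. Qed.

Fact L2scaleDr : right_distributive L2scale +%R.
Proof.
move=> a x y; rewrite -(reprK x) -(reprK y) -raddfD !L2scale_pi -raddfD.
by rewrite scalerDr.
Qed.

Fact L2scaleDl x : {morph L2scale^~ x : a b / a + b}.
Proof. by move=> a b; rewrite -(reprK x) !L2scale_pi -raddfD scalerDl. Qed.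

HB.instance Definition _ := GRing.Zmodule_isLmodule.Build R[i] L2
  L2scaleA L2scale1 L2scaleDr L2scaleDl.

Lemma L2piZ a (f : L2fun) : \pi_L2 (a *: f) = a *: \pi_L2 f.
Proof. by rewrite -L2scale_pi. Qed.

Definition L2inner (x y : L2) : R[i] := L2dot (repr x) (repr y).

Lemma L2inner_pi (f g : L2fun) : L2inner (\pi_L2 f) (\pi_L2 g) = L2dot f g.
Proof.
have E h k l : h - k \in L2null -> L2dot h l = L2dot k l.
  move=> hk; have := L2dot_null l hk.
  by rewrite addrC -scaleN1r L2dotPl mulN1r addrC => /subr0_eq.
rewrite /L2inner (E _ f) ?L2repr_null// L2dotC (E _ g) ?L2repr_null//.
by rewrite -L2dotC.
Qed.

Fact L2inner_linear : bilinear_for *%R (Num.conj \; *%R) L2inner.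
Proof.
have L z : linear_for *%R (L2inner ^~ z).
  move=> a x y; rewrite -(reprK x) -(reprK y) -(reprK z).
  rewrite -[_ *: _]/(L2scale _ _) L2scale_pi -raddfD !L2inner_pi.
  exact: L2dotPl.
have C u v : L2inner u v = Num.conj (L2inner v u) := L2dotC _ _.
by split=> // z a x y; rewrite C L rmorphD rmorphM /= -!C.
Qed.

HB.instance Definition _ := bilinear_isBilinear.Build R[i] L2 L2 R[i]
  *%R (Num.conj \; *%R) L2inner L2inner_linear.

Fact L2inner_herm x y : L2inner x y = (-1) ^+ false * Num.conj (L2inner y x).
Proof. by rewrite expr0 mul1r; exact: L2dotC. Qed.

HB.instance Definition _ := isHermitianSesquilinear.Build R[i] L2 false
  Num.conj L2inner L2inner_herm.

Fact L2inner_gt0 (x : L2) : x != 0 -> 0 < L2inner x x.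
Proof.
rewrite -(reprK x) => x0; rewrite L2inner_pi L2dot_gt0//.
apply: contra x0 => x0; apply/eqP.
by rewrite -(raddf0 \pi_L2); apply/L2eqP; rewrite subr0.
Qed.

HB.instance Definition _ := isDotProduct.Build R[i] L2 L2inner L2inner_gt0.

HB.instance Definition _ := Lmodule_isPreHilbert.Build R L2 L2inner.

End SquareIntegrable.

(* Only the values of [op] on [dom] are meaningful. *)
Record unbounded_operator (C : numFieldType) (H K : lmodType C) := UnboundedOperator {
  dom : set H;
  op :> H -> K;
  dom0 : dom 0;
  domP : forall (a : C) x y, dom x -> dom y -> dom (a *: x + y);
  opP : forall (a : C) x y, dom x -> dom y -> op (a *: x + y) = a *: op x + op y
}.

Section UnboundedOperator.
Context (C : numFieldType) (H K : normedModType C).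
Variable A : unbounded_operator H K.

Definition graph : set (H * K) := [set p | dom A p.1 /\ p.2 = A p.1].
Definition op_range : set K := A @` dom A.
Definition op_kernel : set H := [set x | dom A x /\ A x = 0].

Definition closed_operator := closed graph.
Definition densely_defined := dense (dom A).

End UnboundedOperator.

Definition separable (T : topologicalType) :=
  exists D : set T, countable D /\ dense D.

Definition is_isometry (C : numFieldType) (H K : normedModType C) (U : H -> K) :=
  forall x, `|U x| = `|x|.

Definition orthocompl (R : realType) (H : preHilbertType R) (X : set H) : set H :=
  [set x | forall z, X z -> inner x z = 0].

(* For a bounded operator between Hilbert spaces, and for a closed subspace,
   the vectors selected below exist and are unique; the default value [0] of
   [xget] then plays no role. *)
Definition adjoint (R : realType) (H K : preHilbertType R) (V : H -> K) (y : K)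
    : H :=
  xget 0 [set x | forall z, inner (V z) y = inner z x].

Definition orthoproj (R : realType) (H : preHilbertType R) (X : set H) (x : H)
    : H :=
  xget 0 [set y | X y /\ orthocompl X (x - y)].

Section AdjointProjection.
Context (R : realType) (H K : preHilbertType R).

Lemma adjoint_unique (V : H -> K) (W : K -> H) :
  (forall x y, inner (V x) y = inner x (W y)) -> adjoint V = W.
Proof.
move=> VW; apply/funext => y; apply: xget_unique => [z|w Vw]; first exact: VW.
apply/eqP; rewrite eq_sym -subr_eq0 -(dnorm_eq0 inner) linearBr /=.
by rewrite -VW -Vw subrr.
Qed.

Lemma orthoproj_unique (X : set H) (P : H -> H) :
  (forall x y, X x -> X y -> X (x - y)) ->
  (forall x, X (P x) /\ orthocompl X (x - P x)) -> orthoproj X = P.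
Proof.
move=> XB XP; apply/funext => x; apply: xget_unique => [|y [Xy yP]].
  exact: XP.
have [XPx Px] := XP x; have Xz := XB _ _ XPx Xy.
apply/eqP; rewrite eq_sym -subr_eq0 -(dnorm_eq0 inner).
have -> : inner (P x - y) (P x - y) =
    inner (x - y) (P x - y) - inner (x - P x) (P x - y).
  rewrite -linearBl; congr (inner _ _); by rewrite opprB [RHS]addrC addrA subrK.
by rewrite (yP _ Xz) (Px _ Xz) subr0.
Qed.

End AdjointProjection.

Section MultiplicationOperator.
Context d (T : measurableType d) (R : realType).
Variables (mu : {measure set T -> \bar R}) (sigma : {mfun T >-> R}).
Implicit Types (F G : T -> R[i]) (f g : L2 mu).

Definition L2class F : L2 mu := \pi_(L2 mu) (insubd 0 F).

Definition mulop_fun f : T -> R[i] := fun x => (sigma x)%:C * repr f x.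

Definition mulop_dom : set (L2 mu) :=
  [set f | square_integrable mu (mulop_fun f)].

Lemma reprP a f g : {ae mu, forall x,
  repr (a *: f + g) x = a * repr f x + repr g x}.
Proof.
have : repr (a *: f + g) - (a *: repr f + repr g) \in @L2null _ _ _ mu.
  by apply/L2eqP; rewrite reprK raddfD /= L2piZ !reprK.
by move=> /asboolP; apply: filterS => x; rewrite L2funE => /subr0_eq.
Qed.

Lemma mulop_funP a f g : {ae mu, forall x,
  mulop_fun (a *: f + g) x = a * mulop_fun f x + mulop_fun g x}.
Proof.
by apply: filterS (reprP a f g) => x e; rewrite /mulop_fun e; ring.
Qed.

Lemma measurable_mulop_fun f :
  measurable_fun setT (fun x => complex.Re (mulop_fun f x)) /\
  measurable_fun setT (fun x => complex.Im (mulop_fun f x)).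
Proof.
have /asboolP[mr mi _] := L2valP (repr f).
split.
  rewrite [X in measurable_fun _ X](_ : _ =
    (fun x => sigma x * complex.Re (repr f x))%R); first exact: measurable_funM.
  by apply/funext => x; rewrite /mulop_fun; case: (repr f x) => a b /=; ring.
rewrite [X in measurable_fun _ X](_ : _ =
  (fun x => sigma x * complex.Im (repr f x))%R); first exact: measurable_funM.
by apply/funext => x; rewrite /mulop_fun; case: (repr f x) => a b /=; ring.
Qed.

Lemma ae_square_integrable F G :
  measurable_fun setT (fun x => complex.Re (G x)) ->
  measurable_fun setT (fun x => complex.Im (G x)) ->
  {ae mu, forall x, G x = F x} ->
  square_integrable mu F -> square_integrable mu G.
Proof.
move=> mr mi GF [fr fi iF]; split=> //.
have M (E : T -> R[i]) : measurable_fun setT (fun x => complex.Re (E x)) ->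
  measurable_fun setT (fun x => complex.Im (E x)) ->
  measurable_fun setT (fun x => (Normc.normc (E x) ^+ 2)%:E).
  move=> ? ?; apply/measurable_EFinP; under eq_fun do rewrite sqr_normc.
  by apply: measurable_funD; exact: measurable_funX.
apply: le_lt_trans iF; rewrite le_eqVlt; apply/orP; left; apply/eqP.
apply: ae_eq_integral => //; [exact: M|exact: M|].
by apply: filterS GF => x /= ->.
Qed.

Lemma mulop_dom0 : mulop_dom 0.
Proof.
have [mr mi] := measurable_mulop_fun 0.
apply: (@ae_square_integrable (fun=> 0)) => //; last first.
  have /asboolP := rpred0 (L2pred mu); exact.
have := mulop_funP (-1) 0 0; rewrite scaler0 addr0.
by apply: filterS => x ->; rewrite mulN1r addNr.
Qed.

Lemma mulop_domP a f g :
  mulop_dom f -> mulop_dom g -> mulop_dom (a *: f + g).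
Proof.
move=> df dg; have [mr mi] := measurable_mulop_fun (a *: f + g).
apply: ae_square_integrable (mulop_funP a f g) _ => //.
by have [_ /(_ a _ _ (asboolT df) (asboolT dg))/asboolP] := L2pred_submod_closed mu.
Qed.

Lemma mulopP a f g : mulop_dom f -> mulop_dom g ->
  L2class (mulop_fun (a *: f + g)) =
  a *: L2class (mulop_fun f) + L2class (mulop_fun g).
Proof.
move=> df dg; have dfg := mulop_domP a df dg.
rewrite -L2piZ -raddfD.
apply/L2eqP/asboolP.
apply: filterS (mulop_funP a f g) => x e.
have I h : mulop_dom h -> (insubd 0 (mulop_fun h) : L2fun mu) = mulop_fun h :> (T -> _).
  by move=> dh; rewrite -[LHS]/(val _) insubdK// ; exact/asboolP.
by rewrite L2funE !I// e subrr.
Qed.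

(* Membership in the domain and the value do not depend on the choice of the
   representative [repr f]. *)
Definition mulop : unbounded_operator (L2 mu) (L2 mu) :=
  UnboundedOperator mulop_dom0 mulop_domP mulopP.

End MultiplicationOperator.

Definition borelType (M : ptopologicalType) := g_sigma_algebraType (@open M).

Record condensed_svd (R : realType) (H K : hilbertType R) (M : ptopologicalType)
    (A : unbounded_operator H K)
    (mu : {sigma_finite_measure set (borelType M) -> \bar R})
    (U : {linear L2 mu -> K}) (sigma : {mfun borelType M >-> R})
    (V : {linear L2 mu -> H}) : Prop := CondensedSVD {
  svd_isometryU : is_isometry U;
  svd_isometryV : is_isometry V;
  svd_sigma_ge0 : forall t, 0 <= sigma t;
  svd_sigma_gt0 : {ae mu, forall t, 0 < sigma t};
  svd_dom : dom A = [set x | dom (mulop mu sigma) (adjoint V x)];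
  svd_op : forall x, dom A x -> A x = U (mulop mu sigma (adjoint V x))
}.

(* Main.v *)
(* Everything hinges on the existence of adjoints. The space [L2 mu] is complete
   (Riesz-Fischer), so for an isometry [V] on it and any [y] a minimizing sequence
   of [|y - V x|] converges to a minimizer [x], and [y - V x] is orthogonal to
   [range V]; hence [x = V^* y], [V^* V = 1] and [range V] is closed. Next,
   [range A = U (range T_sigma)], where [T_sigma] has dense range because [f] is
   the limit of [f * (n sigma) / (1 + n sigma)], and [T_sigma] is injective since
   [sigma > 0] a.e. Closing up gives [range U = closure (range A)], and injectivity
   of [U T_sigma] gives [N(V^* ) = N(A)]; the projection formulas follow. *)
Require Import Defs.
From mathcomp Require Import all_boot all_order all_algebra complex.
From mathcomp Require Import generic_quotient sesquilinear.
From mathcomp Require Import all_classical all_reals all_analysis.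
From mathcomp Require Import measurable_realfun ring lra.
Set Implicit Arguments.
Unset Strict Implicit.
Unset Printing Implicit Defensive.
Import Order.TTheory GRing.Theory Num.Theory numFieldNormedType.Exports.
Local Open Scope classical_set_scope.
Local Open Scope ring_scope.
Local Open Scope complex_scope.
Local Open Scope quotient_scope.

(** * Real part of the inner product and real squared norm *)

Section RealInnerProduct.
Context (R : realType) (H : preHilbertType R).
Implicit Types (x y z : H) (t : R).

(** The norm and the inner product take values in [R[i]]; the real part brings estimates into the
    ordered field [R], where infima and limits are taken. *)
Definition rinner x y : R := complex.Re (inner x y).
Definition sqnorm x : R := rinner x x.

Lemma innerC x y : inner x y = Num.conj (inner y x).
Proof. by rewrite (hermC inner) expr0 mul1r. Qed.

Lemma Re_inner_i x y : rinner ('i *: x) y = - complex.Im (inner x y).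
Proof.
rewrite /rinner linearZl_LR /= /GRing.mul/=.
by case: (inner x y) => a b /=; rewrite mul0r sub0r mul1r.
Qed.

Lemma rinnerC x y : rinner x y = rinner y x.
Proof. by rewrite /rinner innerC; case: (inner y x). Qed.

Lemma rinnerDl x y z : rinner (x + y) z = rinner x z + rinner y z.
Proof.
rewrite /rinner linearDl.
have D (a b : R[i]) : complex.Re (a + b) = complex.Re a + complex.Re b.
  by case: a b => [? ?] [].
exact: D.
Qed.

Lemma rinnerNl x z : rinner (- x) z = - rinner x z.
Proof.
rewrite /rinner linearNl.
have N (a : R[i]) : complex.Re (- a) = - complex.Re a by case: a.
exact: N.
Qed.

Lemma rinnerZl t x z : rinner (t%:C *: x) z = t * rinner x z.
Proof.
rewrite /rinner linearZl_LR.
have Z (a : R[i]) : complex.Re (t%:C * a) = t * complex.Re a.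
  by case: a => a b /=; rewrite mul0r subr0.
exact: Z.
Qed.

Lemma rinnerDr x y z : rinner z (x + y) = rinner z x + rinner z y.
Proof. by rewrite rinnerC rinnerDl -!(rinnerC z). Qed.

Lemma rinnerNr x z : rinner z (- x) = - rinner z x.
Proof. by rewrite rinnerC rinnerNl -(rinnerC z). Qed.

Lemma rinnerZr t x z : rinner z (t%:C *: x) = t * rinner z x.
Proof. by rewrite rinnerC rinnerZl -(rinnerC z). Qed.

Definition rinnerE :=
  (rinnerDl, rinnerDr, rinnerNl, rinnerNr, rinnerZl, rinnerZr).

(** A nonnegative element of [R[i]] is real, so taking the real part in [sqnorm] loses nothing. *)
Lemma innerxx x : inner x x = (sqnorm x)%:C.
Proof.
rewrite inner_normE /sqnorm /rinner inner_normE.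
have : (0 : R[i]) <= `|x| ^+ 2 by rewrite exprn_ge0.
by case: (`|x| ^+ 2) => a b; rewrite lecE /= => /andP[/eqP -> _].
Qed.

Lemma sqr_norm x : `|x| ^+ 2 = (sqnorm x)%:C.
Proof. by rewrite -inner_normE innerxx. Qed.

Lemma sqnorm_ge0 x : 0 <= sqnorm x.
Proof. by rewrite -ler0c -sqr_norm exprn_ge0. Qed.

Lemma sqnorm_eq0 x : sqnorm x = 0 -> x = 0.
Proof.
move=> x0; apply/eqP; rewrite -normr_eq0 -sqrf_eq0 sqr_norm x0.
by rewrite -[X in X == _]/(0 : R[i]).
Qed.

Lemma sqnorm_le_orth x y : rinner x y = 0 -> sqnorm x <= sqnorm (x + y).
Proof.
move=> xy; rewrite /sqnorm !rinnerE (rinnerC y) xy !addr0 add0r lerDl.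
exact: sqnorm_ge0.
Qed.

Lemma inner_ext x y : (forall z, inner z x = inner z y) -> x = y.
Proof.
move=> xy; apply/eqP; rewrite -subr_eq0; apply/eqP/sqnorm_eq0.
by rewrite /sqnorm /rinner linearBr /= xy subrr.
Qed.

(** Balls have radii in [R[i]], but a positive radius there is real; closures can thus be handled
    through real squared distances. *)
Lemma closure_sqnormP (X : set H) x : closure X x <->
  forall e : R, 0 < e -> exists2 y, X y & sqnorm (x - y) < e.
Proof.
split=> [cX e e0|xX].
  have s0 : 0 < Num.sqrt e by rewrite sqrtr_gt0.
  have [|y [Xy]] := cX (ball x (Num.sqrt e)%:C).
    by apply: nbhsx_ballx; rewrite ltcR.
  rewrite -ball_normE /= => xy; exists y => //.
  rewrite -ltcR -sqr_norm -[e]sqr_sqrtr ?ltW// rmorphXn /=.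
  by rewrite ltr_pXn2r ?nnegrE// lecR ltW.
move=> B /nbhs_ballP[e /= e0 eB].
have [r r0 er] : exists2 r : R, 0 < r & e = r%:C.
  case: e e0 {eB} => a b; rewrite ltcE /= => /andP[/eqP -> a0].
  by exists a.
have [y Xy xy] := xX _ (exprn_gt0 2 r0).
exists y; split=> //; apply: eB; rewrite -ball_normE /= er.
rewrite -(@ltr_pXn2r _ 2) ?nnegrE ?lecR ?(ltW r0)//.
by rewrite sqr_norm -rmorphXn ltcR.
Qed.

End RealInnerProduct.

(** The real part determines the whole form, since the imaginary part appears, up to sign, as the
    real part at ['i *: x]. *)
Lemma inner_rinner (R : realType) (H K : preHilbertType R) (x y : H) (u v : K) :
  rinner x y = rinner u v -> rinner ('i *: x) y = rinner ('i *: u) v ->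
  inner x y = inner u v.
Proof.
rewrite !Re_inner_i /rinner.
by case: (inner x y) (inner u v) => [a b] [a' b'] /= -> /oppr_inj ->.
Qed.

(** * Linear isometries preserve inner products *)

Section Isometry.
Context (R : realType) (G H : preHilbertType R) (V : {linear G -> H}).
Hypothesis isoV : is_isometry V.

Lemma isometry_sqnorm x : sqnorm (V x) = sqnorm x.
Proof. by apply: (fmorph_inj (real_complex R)); rewrite /= -!sqr_norm isoV. Qed.

(** Polarization: expand the squared norms of [V (x + y)] and [x + y]. *)
Lemma isometry_rinner x y : rinner (V x) (V y) = rinner x y.
Proof.
have := isometry_sqnorm (x + y); rewrite linearD.
have := isometry_sqnorm x; have := isometry_sqnorm y.
rewrite /sqnorm !rinnerE (rinnerC (V y)) (rinnerC y x).
by move=> -> ->; lra.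
Qed.

Lemma isometry_inner x y : inner (V x) (V y) = inner x y.
Proof. by apply: inner_rinner; rewrite -?linearZ isometry_rinner. Qed.

Lemma isometry_inj : injective V.
Proof.
move=> x y Vxy; apply/eqP; rewrite -subr_eq0; apply/eqP/sqnorm_eq0.
by rewrite -isometry_sqnorm linearB Vxy subrr /sqnorm /rinner linear0l.
Qed.

End Isometry.

(** * Completeness of [L2 mu] (Riesz-Fischer), with explicit rates *)

Lemma cvg_of_geometric_steps (R : realType) (a : R^nat) (b : R) :
  (forall n, `|a n.+1 - a n| <= b / 2 ^+ n) ->
  exists2 l, a @ \oo --> l & forall n, `|l - a n| <= 2 * b / 2 ^+ n.
Proof.
(* [r n] is the sum of the geometric bounds on all steps from [n] on. The intervals with centre
   [a n] and radius [r n] are therefore nested, and the supremum of their left ends lies in each of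
   them. *)
move=> ab; pose r n : R := 2 * b / 2 ^+ n.
have b0 : 0 <= b by have := ab 0; rewrite expr0 divr1; exact: le_trans.
have rS n : r n - r n.+1 = b / 2 ^+ n.
  by rewrite /r exprS; field; rewrite expf_neq0.
have r0 n : 0 <= r n by rewrite divr_ge0 ?exprn_ge0 ?mulr_ge0.
have lo : {homo (fun n => a n - r n) : m n / (m <= n)%N >-> m <= n}.
  apply/nondecreasing_seqP => n.
  by have := ab n; rewrite ler_norml -rS => /andP[? _]; lra.
have hi : {homo (fun n => a n + r n) : m n / (m <= n)%N >-> n <= m}.
  apply/nonincreasing_seqP => n.
  by have := ab n; rewrite ler_norml -rS => /andP[_ ?]; lra.
have lohi m n : a m - r m <= a n + r n.
  apply: (@le_trans _ _ (a (maxn m n) - r (maxn m n))); first exact/lo/leq_maxl.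
  apply: (@le_trans _ _ (a (maxn m n) + r (maxn m n))); last exact/hi/leq_maxr.
  by have := r0 (maxn m n); lra.
pose l := sup (range (fun n => a n - r n)).
have la n : `|l - a n| <= r n.
  rewrite ler_norml; apply/andP; split.
    suff : a n - r n <= l by lra.
    apply: ub_le_sup; last by exists n.
    by exists (a 0 + r 0) => _ [m _ <-].
  suff : l <= a n + r n by lra.
  by apply: ge_sup; [exists (a 0 - r 0); exists 0|move=> _ [m _ <-]].
exists l => //.
have rl : r @ \oo --> 0.
  have := @cvg_geometric R (2 * b) 2^-1 _; rewrite ger0_norm// => /(_ _)H.
  rewrite [r](_ : _ = geometric (2 * b) 2^-1).
    by apply: H; rewrite invf_lt1// ltr1n.
  by apply/funext => n; rewrite /r /geometric /= exprVn.
apply/cvgrPdist_le => e e0.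
move/cvgrPdist_le : rl => /(_ _ e0); apply: filterS => n; rewrite sub0r normrN.
by rewrite ger0_norm//; exact: le_trans.
Qed.

(** The weighted series [G] of the squared increments, with weights [4 ^+ k], has integral at most
    the sum of the [2 ^- k], that is 2, so it is finite a.e. Where it is finite, each increment is
    at most the square root of [G] divided by [2 ^+ k]. Hence the sequence converges there, and the
    squared error is at most [4 * 4 ^- n] times [G]; integrating gives the constant 8. *)
Lemma RieszFischer_real d (T : measurableType d) (R : realType)
    (mu : {measure set T -> \bar R}) (u : (T -> R)^nat) :
  (forall n, measurable_fun setT (u n)) ->
  (forall n, \int[mu]_x ((u n.+1 x - u n x) ^+ 2)%:E <= (8 ^- n)%:E)%E ->
  exists2 v : T -> R, measurable_fun setT v &
    forall n, (\int[mu]_x ((v x - u n x) ^+ 2)%:E <= (8 * 4 ^- n)%:E)%E.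
Proof.
move=> mu_ u8.
pose D k x : \bar R := (4 ^+ k * (u k.+1 x - u k x) ^+ 2)%:E.
pose G x : \bar R := (\sum_(0 <= k <oo) D k x)%E.
have D0 k x : (0 <= D k x)%E by rewrite /D lee_fin mulr_ge0// exprn_even_ge0.
have mD2 k : measurable_fun setT (fun x => (u k.+1 x - u k x) ^+ 2).
  by apply: measurable_funX; exact: measurable_funB.
have mD k : measurable_fun setT (D k).
  by apply/measurable_EFinP; exact: measurable_funM.
have mG : measurable_fun setT G.
  by apply: ge0_emeasurable_sum.
have G0 x : (0 <= G x)%E by exact: nneseries_ge0.
have iG : (\int[mu]_x G x <= 2%:E)%E.
  rewrite /G integral_nneseries//.
  apply: lime_le.
    by apply: is_cvg_nneseries => k _ _; exact: integral_ge0.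
  apply: nearW => n.
  apply: (@le_trans _ _ (\sum_(0 <= k < n) (2 ^- k)%:E)%E).
    apply: lee_sum => k _.
    under eq_integral do rewrite /D EFinM.
    rewrite ge0_integralZl//; last 2 first.
    - exact/measurable_EFinP.
    - by move=> x _; rewrite lee_fin sqr_ge0.
    apply: le_trans (lee_wpmul2l _ (u8 k)) _; first by rewrite lee_fin exprn_ge0.
    rewrite -EFinM lee_fin -(_ : 4 * 2 = 8 :> R); last by rewrite -natrM.
    by rewrite exprMn invfM mulrA divff ?mul1r// expf_neq0.
  rewrite sumEFin lee_fin.
  have -> : \sum_(0 <= k < n) 2 ^- k = 2 - 2 / 2 ^+ n :> R.
    elim: n => [|n IH]; first by rewrite big_nil expr0 divr1 subrr.
    by rewrite big_nat_recr//= IH exprS; field; rewrite expf_neq0.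
  by rewrite gerBl divr_ge0// exprn_ge0.
have Gfin : {ae mu, forall x, G x \is a fin_num}.
  have iGG : mu.-integrable setT G.
    apply/integrableP; split=> //.
    under eq_integral do rewrite gee0_abs//.
    exact: le_lt_trans iG (ltry _).
  by apply: filterS (integrable_ae measurableT iGG) => x; exact.
(* The limit superior exists at every point and is measurable. It equals the limit wherever [G] is
   finite, so [fine] alters it only inside a null set. *)
pose v x : R := fine (limn_esup (fun n => (u n x)%:E)).
have mv : measurable_fun setT v.
  apply: measurableT_comp; first exact: fine_measurable.
  by apply: measurable_fun_limn_esup => n; exact/measurable_EFinP.
have vu n : {ae mu, forall x,
    (((v x - u n x) ^+ 2)%:E <= (4 * 4 ^- n)%:E * G x)%E}.
  apply: filterS Gfin => x Gx.
  pose g := fine (G x); have Gg : G x = g%:E by rewrite fineK.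
  have g0 : 0 <= g by rewrite fine_ge0.
  have dg k : `|u k.+1 x - u k x| <= Num.sqrt g / 2 ^+ k.
    rewrite -(@ler_pXn2r _ 2) ?nnegrE ?divr_ge0 ?sqrtr_ge0 ?exprn_ge0//.
    rewrite -normrX ger0_norm ?sqr_ge0// expr_div_n sqr_sqrtr// exprAC.
    rewrite -natrX ler_pdivlMr ?exprn_gt0// mulrC.
    rewrite -lee_fin -[leLHS]/(D k x) -Gg /G.
    by rewrite (@nneseriesD1 _ _ k)// leeDl// nneseries_ge0.
  have [l ul lu] := cvg_of_geometric_steps dg.
  have -> : v x = l.
    rewrite /v; have ulE : EFin \o (u ^~ x) @ \oo --> l%:E by apply: cvg_EFin => //; exact: nearW.
    by have [_ ->] := cvg_limn_einf_sup ulE.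
  rewrite Gg -EFinM lee_fin.
  rewrite -[leLHS]ger0_norm ?sqr_ge0// normrX.
  apply: le_trans (lerXn2r 2 _ _ (lu n)) _; rewrite ?nnegrE ?divr_ge0 ?mulr_ge0 ?sqrtr_ge0 ?exprn_ge0//.
  rewrite !expr_div_n exprMn sqr_sqrtr// -(exprAC _ 2) -!natrX.
  by rewrite mulrAC.
exists v => // n.
apply: (@le_trans _ _ (\int[mu]_x ((4 * 4 ^- n)%:E * G x))%E).
  apply: ae_ge0_le_integral => //.
  - by move=> x _; rewrite lee_fin sqr_ge0.
  - by apply/measurable_EFinP/measurable_funX; exact: measurable_funB.
  - by move=> x _; rewrite mule_ge0// lee_fin divr_ge0// exprn_ge0.
  - exact: measurable_funeM.
  - by apply: filterS (vu n) => x ? _.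
rewrite ge0_integralZl// ?lee_fin ?divr_ge0 ?exprn_ge0//.
apply: le_trans (lee_wpmul2l _ iG) _; first by rewrite lee_fin divr_ge0 ?exprn_ge0.
by rewrite -EFinM lee_fin mulrAC -natrM.
Qed.

Lemma le0_of_le_geometric (R : realType) (a K : R) :
  (forall n, a <= K * 4 ^- n) -> a <= 0.
Proof.
move=> aK.
have cv : geometric K 4^-1 @ \oo --> (0 : R).
  by apply: cvg_geometric; rewrite ger0_norm// invf_lt1// ltr1n.
rewrite -(cvg_lim (@Rhausdorff R) cv).
apply: limr_ge; first by apply/cvg_ex; exists 0.
by apply: nearW => n; rewrite /geometric /= exprVn.
Qed.

Section L2Complete.
Context d (T : measurableType d) (R : realType).
Variable mu : {measure set T -> \bar R}.
Implicit Types (F : T -> R[i]) (f : L2fun mu).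

Lemma measurable_sqr_normc F :
  measurable_fun setT (fun x => complex.Re (F x)) ->
  measurable_fun setT (fun x => complex.Im (F x)) ->
  measurable_fun setT (fun x => (Normc.normc (F x) ^+ 2)%:E).
Proof.
move=> mr mi; apply/measurable_EFinP; under eq_fun do rewrite Defs.sqr_normc.
by apply: measurable_funD; exact: measurable_funX.
Qed.

Lemma sqnorm_piE f :
  ((sqnorm (\pi_(L2 mu) f))%:E = \int[mu]_x (Normc.normc (f x) ^+ 2)%:E)%E.
Proof.
have -> : sqnorm (\pi_(L2 mu) f) = \int[mu]_x (Normc.normc (f x) ^+ 2).
  by rewrite /sqnorm /rinner [inner _ _]L2inner_pi L2dotE.
have /asboolP[_ _ fi] := L2valP f.
rewrite /Rintegral fineK// ge0_fin_numE//.
by apply: integral_ge0 => x _; rewrite lee_fin sqr_ge0.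
Qed.

(** The real result is applied to the real and the imaginary parts of representatives; the two error
    bounds with constant 8 add up to 16. *)
Lemma L2_fast_cauchy (g : (L2 mu)^nat) :
  (forall n, sqnorm (g n.+1 - g n) <= 8 ^- n) ->
  exists h, forall n, sqnorm (h - g n) <= 16 * 4 ^- n.
Proof.
move=> g8; pose F n := repr (g n).
have mR n : measurable_fun setT (fun x => complex.Re (F n x)).
  by have /asboolP[] := L2valP (F n).
have mI n : measurable_fun setT (fun x => complex.Im (F n x)).
  by have /asboolP[] := L2valP (F n).
have F8 n : (\int[mu]_x (Normc.normc (F n.+1 x - F n x) ^+ 2)%:E <= (8 ^- n)%:E)%E.
  have := g8 n; rewrite -(reprK (g n.+1)) -(reprK (g n)) -raddfB -lee_fin.
  by rewrite sqnorm_piE.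
have ReB (a b : R[i]) : complex.Re (a - b) = complex.Re a - complex.Re b.
  by case: a b => [? ?] [].
have ImB (a b : R[i]) : complex.Im (a - b) = complex.Im a - complex.Im b.
  by case: a b => [? ?] [].
have mN n : measurable_fun setT (fun x => (Normc.normc (F n.+1 x - F n x) ^+ 2)%:E).
  apply: measurable_sqr_normc.
    by under eq_fun do rewrite ReB; exact: measurable_funB.
  by under eq_fun do rewrite ImB; exact: measurable_funB.
have [|v mv vF] := @RieszFischer_real _ _ _ mu _ mR.
  move=> n; apply: le_trans (F8 n); apply: ge0_le_integral => //.
  - by move=> x _; rewrite lee_fin sqr_ge0.
  - by apply/measurable_EFinP/measurable_funX; exact: measurable_funB.
  - by move=> x _; rewrite lee_fin Defs.sqr_normc ReB lerDl sqr_ge0.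
have [|w mw wF] := @RieszFischer_real _ _ _ mu _ mI.
  move=> n; apply: le_trans (F8 n); apply: ge0_le_integral => //.
  - by move=> x _; rewrite lee_fin sqr_ge0.
  - by apply/measurable_EFinP/measurable_funX; exact: measurable_funB.
  - by move=> x _; rewrite lee_fin Defs.sqr_normc ImB lerDr sqr_ge0.
pose G x : R[i] := v x +i* w x.
have GF n : (\int[mu]_x (Normc.normc (G x - F n x) ^+ 2)%:E <= (16 * 4 ^- n)%:E)%E.
  under eq_integral do rewrite Defs.sqr_normc ReB ImB EFinD.
  rewrite ge0_integralD//.
  - rewrite (_ : 16 = 8 + 8); last by rewrite -natrD.
    by rewrite mulrDl EFinD leeD// ?vF ?wF.
  - by move=> x _; rewrite lee_fin sqr_ge0.
  - by apply/measurable_EFinP/measurable_funX; exact: measurable_funB.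
  - by move=> x _; rewrite lee_fin sqr_ge0.
  - by apply/measurable_EFinP/measurable_funX; exact: measurable_funB.
have GFL n : (fun x => G x - F n x) \in L2pred mu.
  apply/asboolP; split.
  - by under eq_fun do rewrite ReB; exact: measurable_funB.
  - by under eq_fun do rewrite ImB; exact: measurable_funB.
  - exact: le_lt_trans (GF n) (ltry _).
(* The limit is square integrable because its difference from [F 0] is. *)
have GL : G \in L2pred mu.
  have GE : (fun x => G x - F 0 x) + (F 0 : T -> R[i]) = G.
    by apply/funext => x; rewrite !fctE subrK.
  by rewrite -GE; exact: rpredD (GFL 0) (L2valP (F 0)).
exists (\pi_(L2 mu) (MkL2fun GL)) => n.
by rewrite -(reprK (g n)) -raddfB -lee_fin sqnorm_piE; exact: GF.
Qed.

End L2Complete.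

(** * Existence of the adjoint of an isometry on [L2 mu] *)

Section IsometryAdjoint.
Context d (T : measurableType d) (R : realType).
Variable mu : {measure set T -> \bar R}.
Context (H : preHilbertType R) (V : {linear L2 mu -> H}).
Hypothesis isoV : is_isometry V.

Lemma adjoint_exists (y : H) : exists x, forall z, inner (V z) y = inner z x.
Proof.
pose D := [set sqnorm (y - V x) | x in setT].
have Dinf : has_inf D.
  split; first by exists (sqnorm (y - V 0)); exists 0.
  by exists 0 => _ [x _ <-]; exact: sqnorm_ge0.
(* The parallelogram law will bound the squared steps by [2 * (e n + e n.+1)], hence by [4 * e n];
   the division by 4 makes this exactly [8 ^- n]. *)
pose e n : R := 8 ^- n / 4.
have e0 n : 0 < e n by rewrite divr_gt0// invr_gt0 exprn_gt0.
have Dle x : inf D <= sqnorm (y - V x) by apply: ge_inf; [case: Dinf|exists x].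
have /choice[x xD] n : exists x, sqnorm (y - V x) < inf D + e n.
  by have [_ [x _ <-] ?] := inf_adherent (e0 n) Dinf; exists x.
(* Parallelogram law: minimizing sequences are Cauchy. *)
have x8 n : sqnorm (x n.+1 - x n) <= 8 ^- n.
  have := Dle (2^-1%:C *: (x n.+1 + x n)).
  rewrite -(isometry_sqnorm isoV) linearZ_LR linearB linearD /=.
  have := xD n; have := xD n.+1.
  have : e n.+1 <= e n.
    by rewrite /e ler_pM2r// exprS invfM ler_piMl ?invr_ge0 ?exprn_ge0// invf_le1// ler1n.
  rewrite (_ : 8 ^- n = 4 * e n); last by rewrite /e; field; rewrite expf_neq0.
  move: (V (x n.+1)) (V (x n)) (e n) (e n.+1) (inf D) => a b s t m.
  rewrite /sqnorm !rinnerE (rinnerC b a) (rinnerC a y) (rinnerC b y).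
  lra.
have [h xh] := L2_fast_cauchy x8.
have orth z : rinner (y - V h) (V z) = 0.
  (* The competitor [x n + t%:C *: z] cannot beat the infimum, which [x n] misses by less than
     [e n]. *)
  have near n t : 2 * t * rinner (y - V (x n)) (V z) <= e n + t ^+ 2 * sqnorm z.
    have := Dle (x n + t%:C *: z); have := xD n.
    rewrite -(isometry_sqnorm isoV z) linearD linearZ_LR /=.
    rewrite opprD addrA; move: (y - V (x n)) => w.
    rewrite /sqnorm !rinnerE (rinnerC (V z) w). nra.
  have var t : t * rinner (y - V h) (V z) <= t ^+ 2 * sqnorm z.
    (* Here 17 is 1 + 16: [e n] is at most [4 ^- n], and [sqnorm (h - x n)] at most 16 times that.
       Replacing [x n] by [h] costs a second [t ^+ 2 * sqnorm z], which the factor 2 in [near]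
       absorbs. *)
    rewrite -subr_le0; apply: (@le0_of_le_geometric _ _ 17) => n.
    have en : e n <= 4 ^- n.
      rewrite /e ler_pdivrMr// (@le_trans _ _ (4 ^- n))//.
        by rewrite lef_pV2 ?posrE ?exprn_gt0// lerXn2r ?nnegrE ?ler_nat.
      by rewrite ler_peMr ?invr_ge0 ?exprn_ge0// ler1n.
    have hz : 2 * t * rinner (x n - h) z <= sqnorm (h - x n) + t ^+ 2 * sqnorm z.
      have := sqnorm_ge0 (h - x n + t%:C *: z); rewrite -(opprB (x n)).
      move: (x n - h) => a.
      by rewrite /sqnorm !rinnerE (rinnerC z a); nra.
    have := near n t; have := xh n; move: hz.
    rewrite -(isometry_rinner isoV) linearB.
    rewrite -[y - V h](subrKA (V (x n))) (rinnerDl (y - V (x n))).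
    have q0 : 0 <= 4 ^- n :> R by rewrite invr_ge0 exprn_ge0.
    move: en q0; set q := 4 ^- n; lra.
  have s0 := sqnorm_ge0 z.
  (* With this [t] the inequality [var] reduces to [r ^+ 2 <= 0]; the summand 1 keeps the
     denominator positive when [z] is zero. *)
  have := var (rinner (y - V h) (V z) / (1 + sqnorm z)).
  set r := rinner _ _; set s := sqnorm z in s0 *.
  have s1 : 0 < 1 + s by lra.
  rewrite -subr_ge0 (_ : _ - _ = - (r ^+ 2) / (1 + s) ^+ 2); last first.
    by field; rewrite gt_eqF.
  rewrite pmulr_lge0 ?invr_gt0 ?exprn_gt0// oppr_ge0 => r2.
  by apply/eqP; rewrite -sqrf_eq0 eq_le r2 sqr_ge0.
exists h => z.
(* Real orthogonality to both [V z] and [V ('i *: z)] yields complex orthogonality. *)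
rewrite -(isometry_inner isoV); apply: inner_rinner; rewrite -?linearZ_LR /=.
  by have := orth z; rewrite rinnerC !rinnerE => /eqP; rewrite subr_eq0 => /eqP.
by have := orth ('i *: z); rewrite rinnerC !rinnerE => /eqP; rewrite subr_eq0 => /eqP.
Qed.

End IsometryAdjoint.

(** * Kernel and range of the multiplication operator *)

Section MultiplicationOperatorRange.
Context d (T : measurableType d) (R : realType).
Variables (mu : {measure set T -> \bar R}) (sigma : {mfun T >-> R}).
Implicit Types (f : L2fun mu) (m : T -> R).

Lemma L2class_pi f : L2class mu f = \pi_(L2 mu) f.
Proof. by rewrite /L2class -[L2val f]/(val f) valKd. Qed.

Lemma repr_pi_ae f : {ae mu, forall x, repr (\pi_(L2 mu) f) x = f x}.
Proof.
have /asboolP := L2repr_null f; apply: filterS => x.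
by move/subr0_eq.
Qed.

Lemma normc_scale (r : R) (z : R[i]) :
  Normc.normc (r%:C * z) ^+ 2 = r ^+ 2 * Normc.normc z ^+ 2.
Proof. by rewrite !Defs.sqr_normc; case: z => a b /=; ring. Qed.

Lemma L2pred_scale m f (B : R) : measurable_fun setT m ->
  (forall x, `|m x| <= B) -> (fun x => (m x)%:C * f x) \in L2pred mu.
Proof.
move=> mm mB; have /asboolP[mr mi fi] := L2valP f.
have mR : measurable_fun setT (fun x => complex.Re ((m x)%:C * f x)).
  rewrite [X in measurable_fun _ X](_ : _ = fun x => m x * complex.Re (f x)).
    exact: measurable_funM.
  by apply/funext => x; case: (f x) => a b /=; ring.
have mI : measurable_fun setT (fun x => complex.Im ((m x)%:C * f x)).
  rewrite [X in measurable_fun _ X](_ : _ = fun x => m x * complex.Im (f x)).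
    exact: measurable_funM.
  by apply/funext => x; case: (f x) => a b /=; ring.
apply/asboolP; split=> //.
apply: (@le_lt_trans _ _
    (\int[mu]_x ((B ^+ 2)%:E * (Normc.normc (f x) ^+ 2)%:E))%E).
  apply: ge0_le_integral => //.
  - by move=> x _; rewrite lee_fin sqr_ge0.
  - exact: measurable_sqr_normc.
  - by apply: measurable_funeM; exact: measurable_sqr_normc.
  - move=> x _; rewrite -EFinM lee_fin normc_scale ler_wpM2r ?sqr_ge0//.
    by rewrite -[leLHS]ger0_norm ?sqr_ge0// normrX lerXn2r ?nnegrE// (le_trans _ (mB x)).
rewrite ge0_integralZl//.
- by rewrite lte_mul_pinfty// lee_fin sqr_ge0.
- exact: measurable_sqr_normc.
- by move=> x _; rewrite lee_fin sqr_ge0.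
- by rewrite lee_fin sqr_ge0.
Qed.

(** [mulop] is computed on a chosen representative; this lemma makes it usable with any square
    integrable function that agrees a.e. with the product. *)
Lemma mulopE f (h : L2 mu) : {ae mu, forall x, mulop_fun sigma h x = f x} ->
  dom (mulop mu sigma) h /\ mulop mu sigma h = \pi_(L2 mu) f.
Proof.
move=> hf; have [mr mi] := measurable_mulop_fun sigma h.
have dh : mulop_dom sigma h.
  apply: ae_square_integrable hf _ => //; exact/asboolP/L2valP.
split=> //.
have dh' : mulop_fun sigma h \in L2pred mu by exact/asboolP.
rewrite /= -[mulop_fun sigma h]/(L2val (MkL2fun dh')) L2class_pi.
apply/L2eqP/asboolP; apply: filterS hf => x /= hx.
by rewrite [LHS](_ : _ = mulop_fun sigma h x - f x)// hx subrr.
Qed.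

Hypothesis sigma_ge0 : forall t, 0 <= sigma t.
Hypothesis sigma_gt0 : {ae mu, forall t, 0 < sigma t}.

Lemma mulop_ker (h : L2 mu) :
  dom (mulop mu sigma) h -> mulop mu sigma h = 0 -> h = 0.
Proof.
move=> dh.
have dh' : mulop_fun sigma h \in L2pred mu by exact/asboolP.
rewrite /= -[mulop_fun sigma h]/(L2val (MkL2fun dh')) L2class_pi.
have pi0 : \pi_(L2 mu) (0 : L2fun mu) = 0 :> L2 mu by exact: raddf0.
move=> hz; have {hz}/L2eqP/asboolP h0 :
  \pi_(L2 mu) (MkL2fun dh') = \pi_(L2 mu) (0 : L2fun mu) by rewrite pi0.
rewrite -[h]reprK -[RHS]pi0; apply/L2eqP/asboolP.
apply: filterS2 h0 sigma_gt0 => x /= + sx.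
rewrite [X in X = _ -> _](_ : _ = (sigma x)%:C * repr h x - 0)//.
rewrite [X in _ -> X = _](_ : _ = repr h x - 0)// !subr0 => /eqP.
by rewrite mulf_eq0 => /orP[/eqP[s0]|/eqP//]; rewrite s0 ltxx in sx.
Qed.

(* [damp n = 1 / (1 + n sigma)]: multiplying by [1 - damp n = sigma * (n damp n)]
   lands in the range of the operator, and [damp n] tends to [0] a.e. *)
Let damp n x : R := (1 + n%:R * sigma x)^-1.

Let damp_den n x : 1 <= 1 + n%:R * sigma x.
Proof. by rewrite lerDl mulr_ge0. Qed.

Let damp_gt0 n x : 0 < damp n x.
Proof. by rewrite invr_gt0 (lt_le_trans _ (damp_den n x)). Qed.

Let damp_ge0 n x : 0 <= damp n x.
Proof. exact: ltW. Qed.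

Let damp_le1 n x : damp n x <= 1.
Proof. by rewrite invf_le1// (lt_le_trans _ (damp_den n x)). Qed.

Let measurable_damp n : measurable_fun setT (damp n).
Proof.
(* Measurability of the inverse is drawn from that of [powR]; the two agree because the denominator
   is nonnegative. *)
have -> : damp n = (@powR R ^~ (- 1)) \o (fun x => 1 + n%:R * sigma x).
  by apply/funext => x /=; rewrite powR_inv1// (le_trans _ (damp_den n x)).
apply: measurableT_comp; first exact: measurable_powR.
by apply: measurable_funD => //; exact: measurable_funM.
Qed.

Let sigma_damp n x : sigma x * (n%:R * damp n x) = 1 - damp n x.
Proof. by rewrite /damp; field; rewrite gt_eqF// (lt_le_trans _ (damp_den n x)). Qed.

Let cvg_damp x : 0 < sigma x -> damp ^~ x @ \oo --> 0.
Proof.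
move=> sx; apply/gtr0_cvgV0.
  by apply: nearW => n; rewrite (lt_le_trans _ (damp_den n x)).
apply: cvg_comp (cvg_addrl 1).
exact: (@cvg_comp _ _ _ (fun n : nat => n%:R) (fun r : R => r * sigma x) _ _ _
  cvgr_idn (gt0_cvgMly sx cvg_id)).
Qed.

Lemma mulop_range_dense (g : L2 mu) (e : R) : 0 < e ->
  exists2 h, dom (mulop mu sigma) h & sqnorm (g - mulop mu sigma h) < e.
Proof.
move=> e0; pose f := repr g.
(* For fixed [n] the multiplier is bounded by [n], so the preimage [h n] stays in [L2 mu]. *)
have dampL n : (fun x => (n%:R * damp n x)%:C * f x) \in L2pred mu.
  apply: (@L2pred_scale _ _ n%:R); first exact: measurable_funM.
  by move=> x; rewrite ger0_norm ?mulr_ge0// ler_piMr.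
have ndampL n : (fun x => (1 - damp n x)%:C * f x) \in L2pred mu.
  apply: (@L2pred_scale _ _ 1); first exact: measurable_funB.
  by move=> x; rewrite ger0_norm ?subr_ge0// gerBl.
pose h n := \pi_(L2 mu) (MkL2fun (dampL n)).
have hE n : dom (mulop mu sigma) (h n) /\
    mulop mu sigma (h n) = \pi_(L2 mu) (MkL2fun (ndampL n)).
  apply: mulopE; apply: filterS (repr_pi_ae (MkL2fun (dampL n))) => x /= E.
  by rewrite /mulop_fun E mulrA -rmorphM /= sigma_damp.
have /asboolP[mr mi fi] := L2valP f.
have sq n : (sqnorm (g - mulop mu sigma (h n)))%:E =
    (\int[mu]_x (damp n x ^+ 2 * Normc.normc (f x) ^+ 2)%:E)%E.
  rewrite (hE n).2 -[g]reprK -raddfB sqnorm_piE; apply: eq_integral => x _.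
  rewrite [L2val _ x](_ : _ = f x - (1 - damp n x)%:C * f x)//.
  by rewrite -normc_scale rmorphB rmorph1 mulrBl mul1r subKr.
have mf := measurable_sqr_normc mr mi.
(* The error left by [h n] is [damp n] times [f]. It tends to 0 wherever [sigma] is positive, and
   its squared modulus is dominated by that of [f] because [damp n] lies between 0 and 1. *)
have [|||||_ _] := @dominated_convergence _ _ _ mu setT measurableT
  (fun n x => (damp n x ^+ 2 * Normc.normc (f x) ^+ 2)%:E) (cst 0%E)
  (fun x => (Normc.normc (f x) ^+ 2)%:E).
- move=> n; apply/measurable_EFinP/measurable_funM; first exact: measurable_funX.
  exact/measurable_EFinP.
- by [].
- apply: filterS sigma_gt0 => x sx _.
  apply: cvg_EFin; first exact: nearW.
  rewrite -[X in _ --> X](mul0r (Normc.normc (f x) ^+ 2)); apply: cvgMl.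
  rewrite -[X in _ --> X](mul0r 0); under eq_fun do rewrite expr2.
  by apply: cvgM; exact: cvg_damp.
- apply/integrableP; split=> //.
  by under eq_integral do rewrite gee0_abs ?lee_fin ?sqr_ge0//.
- apply: nearW => x n _.
  have f0 : 0 <= Normc.normc (f x) ^+ 2 :> R by exact: sqr_ge0.
  have d2 : damp n x ^+ 2 <= 1 by rewrite expr_le1.
  by rewrite gee0_abs lee_fin; [exact: ler_piMl|rewrite mulr_ge0// sqr_ge0].
rewrite integral0 => cv0.
have {cv0}/fine_cvgP[_ cv0] :
    (fun n => (sqnorm (g - mulop mu sigma (h n)))%:E) @ \oo --> 0%E.
  by under eq_fun do rewrite sq.
move/cvgrPdist_lt : cv0 => /(_ _ e0)[n _ /(_ n (leqnn n))].
rewrite sub0r normrN ger0_norm ?sqnorm_ge0// => hn.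
by exists (h n) => //; exact: (hE n).1.
Qed.

End MultiplicationOperatorRange.

(** * Calculus of the adjoint of an isometry *)

Section AdjointIsometry.
Context d (T : measurableType d) (R : realType).
Variable mu : {measure set T -> \bar R}.
Context (H : preHilbertType R) (V : {linear L2 mu -> H}).
Hypothesis isoV : is_isometry V.

(** Existence rules out the default value of [xget], so the selected vector has the defining
    property. *)
Lemma adjointP y z : inner (V z) y = inner z (adjoint V y).
Proof.
have [x xP] := adjoint_exists isoV y.
have /(xgetPex 0) : exists x, [set x | forall z, inner (V z) y = inner z x] x.
  by exists x.
exact.
Qed.

(** Preservation of inner products makes [x] a solution of the equation defining the adjoint at
    [V x], and solutions are unique. *)
Lemma adjointK x : adjoint V (V x) = x.
Proof.
apply: xget_unique => [z|w /= xw]; first exact: isometry_inner.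
by apply: inner_ext => z; rewrite -[LHS]xw; exact: isometry_inner.
Qed.

Lemma inner_adjoint y z : inner y (V z) = inner (adjoint V y) z.
Proof. by rewrite innerC adjointP -innerC. Qed.

(** This identifies [V (adjoint V y)] as the orthogonal projection of [y] onto the range of [V]. *)
Lemma inner_sub_adjoint y z : inner (y - V (adjoint V y)) (V z) = 0.
Proof. by rewrite linearBl /= inner_adjoint isometry_inner// subrr. Qed.

(** The adjoint is selected point by point, so compatibility with subtraction is derived from
    uniqueness. *)
Lemma adjointB x y : adjoint V (x - y) = adjoint V x - adjoint V y.
Proof.
apply: xget_unique => [z|w /= xw]; first by rewrite !linearBr /= !adjointP.
by apply: inner_ext => z; rewrite -[LHS]xw !linearBr /= !adjointP.
Qed.

(** By Pythagoras [V (adjoint V y)] is the point of the range nearest to [y]; for [y] in the closure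
    that distance is 0. *)
Lemma closed_isometry_range : closure (range V) = range V.
Proof.
apply/seteqP; split; last exact: subset_closure.
move=> y /closure_sqnormP cy; exists (adjoint V y) => //.
apply/eqP; rewrite eq_sym -subr_eq0; apply/eqP/sqnorm_eq0/eqP.
rewrite eq_le sqnorm_ge0 andbT; apply/ler_addgt0Pr => e e0; rewrite add0r.
have [_ [z _ <-]] := cy _ e0 => /ltW; apply: le_trans.
have -> : y - V z = y - V (adjoint V y) + V (adjoint V y - z).
  by rewrite linearB /= subrKA.
by apply: sqnorm_le_orth; rewrite /rinner inner_sub_adjoint.
Qed.

End AdjointIsometry.

(** * The four identities for the singular value decomposition *)

Lemma op0 (C : numFieldType) (H K : lmodType C) (A : unbounded_operator H K) :
  A 0 = 0.
Proof.
by have := opP (-1) (dom0 A) (dom0 A); rewrite scaler0 addr0 scaleN1r addNr.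
Qed.

Theorem proposition4p5 (R : realType) (H K : hilbertType R)
    (sepH : separable H) (sepK : separable K)
    (A : unbounded_operator H K)
    (closedA : closed_operator A) (denseA : densely_defined A)
    (M : ptopologicalType)
    (mu : {sigma_finite_measure set (borelType M) -> \bar R})
    (U : {linear L2 mu -> K}) (sigma : {mfun borelType M >-> R})
    (V : {linear L2 mu -> H})
    (svdA : condensed_svd A U sigma V) :
  [/\ range U = closure (op_range A),
      [set x | adjoint V x = 0] = op_kernel A,
      V \o adjoint V = orthoproj (orthocompl (op_kernel A)) &
      U \o adjoint U = orthoproj (closure (op_range A))].

Proof.
have [isoU isoV s0 sp domA opA] := svdA.
have rU : range U = closure (op_range A).
  apply/seteqP; split.
    move=> _ [g _ <-]; apply/closure_sqnormP => e e0.
    (* The isometry [U] transports approximation by the range of [mulop] to the range of [U]. The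
       vector [V h] is a preimage under [A] of the approximant, because its adjoint image is [h]. *)
    have [h dh gh] := mulop_range_dense s0 sp g e0.
    have dAh : dom A (V h) by rewrite domA /= adjointK.
    exists (A (V h)); first by exists (V h).
    by rewrite opA// adjointK// -linearB isometry_sqnorm.
  rewrite -(closed_isometry_range isoU); apply: closureS => _ [x dx <-].
  by exists (mulop mu sigma (adjoint V x)); rewrite // opA.
have kA : [set x | adjoint V x = 0] = op_kernel A.
  apply/seteqP; split=> x /=.
    (* Since 0 belongs to the domain of [mulop], the domain formula of the decomposition puts [x] in
       [dom A]. *)
    move=> x0; have dx : dom A x by rewrite domA /= x0; exact: (dom0 (mulop mu sigma)).
    by split=> //; rewrite opA// x0 op0 linear0.
  move=> [dx]; rewrite opA// => Ux0.
  apply: (mulop_ker sp); first by move: dx; rewrite domA.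
  by apply: (isometry_inj isoU); rewrite Ux0 linear0.
split=> //.
  apply/esym/orthoproj_unique => [x y ox oy z kz|x].
    by rewrite linearBl /= ox ?oy ?subrr.
  (* With the kernel of [A] rewritten as that of the adjoint, [V (adjoint V x)] is orthogonal to it
     by adjunction, and [x - V (adjoint V x)] belongs to it, hence is orthogonal to its
     complement. *)
  rewrite -kA; split=> [z /= z0|z oz].
    by rewrite adjointP// z0 linear0r.
  rewrite innerC oz ?conjC0//=.
  by rewrite adjointB// adjointK// subrr.
rewrite -rU; apply/esym/orthoproj_unique.
  by move=> _ _ [x _ <-] [y _ <-]; exists (x - y); rewrite // linearB.
move=> x; split; first by exists (adjoint U x).
by move=> _ [z _ <-]; exact: inner_sub_adjoint.
Qed.
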